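(* Let $(X,\tau)$ be a first countable $T_1$ space. If $X$ is not a Hausdorff space, then there exist a set-valued map $S:X\rightrightarrows X$ and an infinite $S$-orbit $M:=\{x_i\}_{i=1}^{\infty}$ with a strong accumulation point $\bar{x}$ such that $S$ is lower semicontinuous on $M$ at $\bar{x}$ and $S(\bar{x})\nsubseteq\{\bar{x}\}$.
   Context: A set-valued map $S:X\rightrightarrows X$ assigns to each $x\in X$ a (possibly empty) subset $S(x)\subseteq X$; $\operatorname{dom} S:=\{x\in X:S(x)\ne\emptyset\}$. An infinite $S$-orbit is a sequence $\{x_i\}_{i=1}^\infty$ in $X$ with $x_{i+1}\in S(x_i)$ for all $i\ge1$. A point $\bar x\in X$ is a strong accumulation point of an infinite $S$-orbit $\{x_i\}_{i=1}^\infty$ if every neighborhood $U_{\bar x}$ of $\bar x$ satisfies $\{x_i\}\cup S(x_i)\subseteq U_{\bar x}$ for infinitely many $i$; equivalently (in a first countable space) there is a subsequence $\{x_{i_k}\}_{k=1}^\infty$ with $x_{i_k}\to\bar x$ and such that whenever $a_k\in S(x_{i_k})$ for all $k$, also $a_k\to\bar x$ as $k\to\infty$. Writing $M$ also for the set of points of the orbit and $\operatorname{cl}M$ for its closure, $S$ is lower semicontinuous on $M$ at $x\in\operatorname{cl}M\cap\operatorname{dom}S$ if for every open $V\subseteq X$ with $S(x)\cap V\ne\emptyset$ there is an open neighborhood $U\subseteq X$ of $x$ such that $S(x')\cap V\neq\emptyset$ for all $x'\in U\cap M$. *)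

(* Defs.v *)
From HB Require Import structures.
From mathcomp Require Import all_boot all_order.
From mathcomp Require Import boolp classical_sets functions cardinality filter.
From mathcomp Require Import topology.

Set Implicit Arguments.
Unset Strict Implicit.
Unset Printing Implicit Defensive.

Local Open Scope classical_set_scope.

Definition first_countable (X : topologicalType) : Prop :=
  forall x : X, exists B : set (set X),
    [/\ countable B, B `<=` nbhs x &
        forall U, nbhs x U -> exists2 V, B V & V `<=` U].

(* A set-valued map from X to X is a function S : X -> set X. *)

Definition svdom (X : Type) (S : X -> set X) : set X :=
  [set x | S x !=set0].

(* Orbits are indexed from 0. *)
Definition infinite_orbit (X : Type) (S : X -> set X) (x : nat -> X) : Prop :=
  forall i, S (x i) (x i.+1).

Definition strong_accumulation_point (X : topologicalType) (S : X -> set X)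
    (x : nat -> X) (xbar : X) : Prop :=
  forall U, nbhs xbar U ->
    infinite_set [set i | [set x i] `|` S (x i) `<=` U].

(* Lower semicontinuity on M at x presupposes that x lies in the closure of M
   and in the domain of S; this is part of the definition. *)
Definition lsc_on_at (X : topologicalType) (S : X -> set X) (M : set X)
    (x : X) : Prop :=
  (closure M `&` svdom S) x /\
  forall V, open V -> S x `&` V !=set0 ->
    exists2 U, open_nbhs x U &
      forall x', (U `&` M) x' -> S x' `&` V !=set0.

(* Main.v *)
Require Import Defs.
From HB Require Import structures.
From mathcomp Require Import all_boot all_order.
From mathcomp Require Import boolp classical_sets functions cardinality filter.
From mathcomp Require Import topology.

Local Open Scope classical_set_scope.

(** Since [X] is first countable and not Hausdorff, some sequence [x] converges
    to two distinct points [p] and [q], and by T1 it can be chosen to avoid [p].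
    Let [S] send [p] to [{q}] and each term of the sequence to the terms that
    come after it. As [x] converges to [q], every tail of [x] meets every open
    set containing [q], which is lower semicontinuity at [p]. As [X] is T1 and
    [x] avoids [p], each value is taken finitely often, so that [S (x i)] is
    contained in late tails of [x], hence in a given neighborhood of [p], for
    all large [i]. *)

(** Finite intersections along an enumeration of a countable basis decrease, so once one lies in
    [U], all later ones do. *)
Lemma first_countable_decreasing_basis {X : topologicalType} (p : X) :
  first_countable X ->
  exists2 B : nat -> set X, forall n, nbhs p (B n) &
    forall U, nbhs p U -> exists n, forall m, n <= m -> B m `<=` U.
Proof.
move=> /(_ p)[F [Fcount Fnbhs Fbasis]].
have [F0|[f]] := pfcard_geP Fcount.
  (* [F] cannot be empty: some member lies inside the neighborhood [setT]. *)
  by have [V] := Fbasis setT filterT; rewrite F0.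
exists (fun n => \bigcap_(k in `I_n.+1) f k) => [n|U /Fbasis[V FV VU]].
  rewrite bigcap_mkord; elim/big_ind: _ => [|A A' pA pA'|k _].
  - exact: filterT.
  - exact: filterI.
  - exact/Fnbhs/funS.
have [n _ fnV] := 'surj_f FV.
by exists n => m nm y By; apply: VU; rewrite -fnV; apply: By; rewrite /= ltnS.
Qed.

Lemma accessible_nbhs_neq {X : topologicalType} {p y : X} :
  accessible_space X -> y <> p -> nbhs p [set z | z <> y].
Proof.
move=> XT1 yp; have /XT1[A [Aopen []]] : p != y by apply/eqP => /esym.
rewrite !inE => Ap Ay; apply: (filterS _ (open_nbhs_nbhs (conj Aopen Ap))).
by move=> z Az zy; apply: Ay; rewrite -zy.
Qed.

Lemma cluster_nbhs_cvg {X : topologicalType} {p q : X} :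
  first_countable X -> accessible_space X -> cluster (nbhs p) q -> p <> q ->
  exists x : nat -> X,
    [/\ x @ \oo --> p, x @ \oo --> q & forall n, x n <> p].
Proof.
move=> Xfc XT1 pq_cluster pq.
have [B Bp Bbasis] := first_countable_decreasing_basis p Xfc.
have [C Cq Cbasis] := first_countable_decreasing_basis q Xfc.
have /choice[x xP] n : exists y, [/\ B n y, C n y & y <> p].
  (* By T1 the complement of [p] is a neighborhood of [q], so it may be intersected with [C n]. *)
  have [y [By [Cy yp]]] :=
    pq_cluster _ _ (Bp n) (filterI (Cq n) (accessible_nbhs_neq XT1 pq)).
  by exists y.
exists x; split => [U /Bbasis[n BU]|U /Cbasis[n CU]|n]; last by case: (xP n).
- by exists n => // m /= /BU; apply; case: (xP m).
- by exists n => // m /= /CU; apply; case: (xP m).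
Qed.

Lemma cvg_eventually_neq_initial {X : topologicalType} {x : nat -> X} {p : X}
    (n : nat) :
  accessible_space X -> x @ \oo --> p -> (forall i, x i <> p) ->
  \forall i \near \oo, forall k, k < n -> x i <> x k.
Proof.
move=> XT1 xp x_neq; elim: n => [|n IHn]; first exact: nearW.
apply: filterS2 IHn (xp _ (accessible_nbhs_neq XT1 (x_neq n))) => i lt_neq xin k.
by rewrite ltnS leq_eqVlt => /orP[/eqP->//|/lt_neq].
Qed.

Lemma near_infinite_set (P : set nat) :
  (\forall i \near \oo, P i) -> infinite_set P.
Proof.
move=> [N _ NP] /finite_seqP[s Ps].
pose m := maxn N (\max_(i <- s) i).+1.
have : P m by apply: NP; rewrite /= leq_maxl.
rewrite Ps /= => /(@leq_bigmax_seq _ _ xpredT id)/(_ isT).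
by rewrite /m leqNgt leq_maxr.
Qed.

Theorem proposition4p5 (X : topologicalType)
    (X_first_countable : first_countable X)
    (X_T1 : accessible_space X)
    (X_not_hausdorff : ~ hausdorff_space X) :
  exists (S : X -> set X) (x : nat -> X) (xbar : X),
    [/\ infinite_orbit S x,
        strong_accumulation_point S x xbar,
        lsc_on_at S (range x) xbar &
        ~ (S xbar `<=` [set xbar])].
Proof.
have [p [q [pq_cluster pq]]] : exists p q : X, cluster (nbhs p) q /\ p <> q.
  apply: contra_notP X_not_hausdorff => no_pq p q pq_cluster.
  by apply: contra_notP no_pq => pq; exists p, q.
have [x [xp xq x_neq]] :=
  cluster_nbhs_cvg X_first_countable X_T1 pq_cluster pq.
pose S (y : X) := [set z | (y = p /\ z = q) \/
  exists i j, [/\ i < j, y = x i & z = x j]].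
have Spq : S p q by left.
exists S, x, p; split.
- by move=> i; right; exists i, i.+1.
- move=> U pU; apply: near_infinite_set.
  have [N _ NU] := xp U pU.
  (* The sequence may repeat values, so [x i] may equal several [x k]; for large [i] every such [k]
     is at least [N], which puts each [x j] with [j > k] in [U]. *)
  apply: filterS2 (cvg_eventually_neq_initial N X_T1 xp x_neq) (xp U pU).
  move=> i x_neq_initial xiU z [->//|[[/x_neq//]|[k [j [kj xik ->]]]]].
  apply: NU => /=; apply: leq_trans (ltnW kj).
  by rewrite leqNgt; apply/negP => /x_neq_initial; apply.
- split.
    split; last by exists q.
    move=> U /xp[N _ NU]; exists (x N).
    by split; [exists N|apply: NU => /=].
  (* The whole space serves as [U], because every [S (x i)] meets [V]. *)
  move=> V Vopen [z [Spz Vz]]; exists setT.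
    by split => //; exact: openT.
  have {Spz} zq : z = q.
    by case: Spz => [[]//|[i [j [_ /esym/x_neq]]]].
  rewrite {}zq in Vz.
  have [N _ NV] := xq V (open_nbhs_nbhs (conj Vopen Vz)).
  (* The index must exceed [i] to give a point of [S (x i)] and reach [N] to give a point of [V]. *)
  move=> _ [_ [i _ <-]]; exists (x (maxn N i.+1)); split.
    by right; exists i, (maxn N i.+1); split => //; rewrite leq_maxr.
  by apply: NV; rewrite /= leq_maxl.
- by move=> /(_ q Spq) /esym.
Qed.
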